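(* Let $p\ge2$ be an integer, $\mu\ge0$, $s>0$. Let $h:\mathbb{R}^n\to\mathbb{R}$ be $1$-uniformly convex of order $p$, and let $f:\mathbb{R}^n\to\mathbb{R}$ be $\mu$-uniformly convex (possibly $\mu=0$) with respect to $h$ and $\frac{(p-1)!}{s}$-smooth of order $p-1$, with a minimizer $x^*$. Let $G_{p,M}$ be a tensor update operator with constant $M>0$ and let $C=\frac1p\left(\frac{M}{p-1}\right)^{p-1}$. Let $(\mathbf{t}_k)_{k\ge0}$ be a strictly increasing sequence in $[0,\infty)$, set $A_k=C\mathbf{t}_k^p\operatorname{sinhc}_p^p\left(C^{1/p}\mu^{1/p}\mathbf{t}_k\right)$, and suppose that for all $k\ge0$ $$(A_{k+1}-A_k)^p-Cp^psA_{k+1}^{p-1}(1+\mu A_k)\le0.$$ Let the iterates of the unified accelerated tensor method family be generated from $x_0=z_0\in\mathbb{R}^n$ by, for $k\ge0$, $$y_k=x_k+\frac{A_{k+1}-A_k}{A_{k+1}}(z_k-x_k),\qquad x_{k+1}=G_{p,M}(y_k),$$ $$z_{k+1}=\arg\min_z\left\{\frac{A_{k+1}-A_k}{1+\mu A_k}\left(\langle\nabla f(x_{k+1}),z\rangle+\mu D_h(z,x_{k+1})\right)+D_h(z,z_k)\right\}.$$ Then $$\mathcal{E}_k=(1+\mu A_k)D_h(x^*,z_k)+A_k\left(f(x_k)-f(x^* )\right)$$ is monotonically decreasing (non-increasing) in $k$.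
   Context: $\sinh_p:[0,\infty)\to\mathbb{R}$ solves $\sinh_p'(t)=(1+\sinh_p^p(t))^{1/p}$, $\sinh_p(0)=0$; $\operatorname{sinhc}_p(x)=\sinh_p(x)/x$ for $x\ne0$, $\operatorname{sinhc}_p(0)=1$. The functions $f,h$ are continuously differentiable ($f$ also $p-1$ times differentiable). $D_g(y,x)=g(y)-g(x)-\langle\nabla g(x),y-x\rangle$. $h$ is $1$-uniformly convex of order $p$ if $D_h(y,x)\ge\frac1p\|y-x\|^p$ for all $x,y$. $f$ (convex) is $\mu$-uniformly convex with respect to $h$ if $D_f(x,y)\ge\mu D_h(x,y)$ for all $x,y$. $f$ is $L$-smooth of order $p-1$ if $\|\nabla^{p-1}f(y)-\nabla^{p-1}f(x)\|\le L\|y-x\|$ for all $x,y$. Tensor update operator: for $N>0$, $G_{p,s,N}(y)=\arg\min_x\left\{f_{p-1}(x;y)+\frac{N}{ps}\|x-y\|^p\right\}$, where $f_{p-1}(x;y)=\sum_{i=0}^{p-1}\frac{1}{i!}\nabla^if(y)(x-y)^i$ is the $(p-1)$-st order Taylor approximation of $f$ at $y$. $G_{p,M}:\mathbb{R}^n\to\mathbb{R}^n$ denotes such an operator, with $N$ chosen so that for every $y$, the point $x=G_{p,M}(y)$ satisfies $$\langle\nabla f(x),y-x\rangle\ge Ms^{\frac{1}{p-1}}\|\nabla f(x)\|^{\frac{p}{p-1}}.$$ *)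

(* Defs.v *)
From HB Require Import structures.
From mathcomp Require Import all_boot all_order all_algebra.
From mathcomp Require Import all_classical all_reals all_analysis.

Set Implicit Arguments.
Unset Strict Implicit.
Unset Printing Implicit Defensive.

Import Order.TTheory GRing.Theory Num.Theory.
Import numFieldNormedType.Exports.

Local Open Scope classical_set_scope.
Local Open Scope ring_scope.

Section Euclidean.
Variables (R : realType) (n : nat).
Implicit Types (f g h : 'rV[R]_n -> R) (x y z u v : 'rV[R]_n).

Definition dot u v : R := \sum_(i < n) u 0 i * v 0 i.

(* The library norm `|u| on row vectors is the sup norm; it has the same
   topology, and hence the same derivatives, as this Euclidean one. *)
Definition enorm u : R := Num.sqrt (dot u u).

Definition grad g x : 'rV[R]_n := \row_i 'D_(delta_mx 0 i) g x.

Definition continuously_differentiable g :=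
  (forall x, differentiable g x) /\ continuous (grad g).

(* k-fold Frechet differentiability on all of R^n.  In finite dimension the
   map x |-> 'd g x is differentiable iff x |-> 'd g x v = 'D_v g x is, for
   every fixed v. *)
Fixpoint times_differentiable (k : nat) g : Prop :=
  if k is k'.+1 then
    (forall x, differentiable g x) /\
    (forall v, times_differentiable k' ('D_v g))
  else True.

(* The k-th derivative of g at x as a k-linear form: with k = size vs,
   tensor g vs x is nabla^k g (x) [v_1, ..., v_k]. *)
Definition tensor g (vs : seq 'rV[R]_n) : 'rV[R]_n -> R :=
  foldr (fun v g' => 'D_v g') g vs.

(* Operator norm of a q-linear form with respect to the Euclidean norm. *)
Definition tensor_norm (q : nat) (T : q.-tuple 'rV[R]_n -> R) : \bar R :=
  ereal_sup [set `|T v|%:E | v in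
    [set v : q.-tuple 'rV[R]_n | forall i, enorm (tnth v i) <= 1]].

Definition smooth_of_order (q : nat) (L : R) f := forall x y,
  (tensor_norm (fun v : q.-tuple 'rV[R]_n => (tensor f v y - tensor f v x)%R)
    <= (L * enorm (y - x)%R)%:E)%E.

Definition bregman g y x : R := g y - g x - dot (grad g x) (y - x).

Definition uniformly_convex_order (p : nat) h := forall x y,
  p%:R^-1 * enorm (y - x) ^+ p <= bregman h y x.

Definition uniformly_convex_wrt (mu : R) h f :=
  convex_function [set: 'rV[R]_n] f /\
  forall x y, mu * bregman h x y <= bregman f x y.

Definition is_argmin f x := forall y, f x <= f y.

(* Taylor approximation of order p - 1 of f at y, evaluated at x. *)
Definition taylor (p : nat) f x y : R :=
  \sum_(i < p) (i`!%:R)^-1 * tensor f (nseq i (x - y)) y.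

(* The argmin need not be unique: G picks one minimizer for each y. *)
Definition tensor_update (p : nat) (s N : R) f (G : 'rV[R]_n -> 'rV[R]_n) :=
  forall y, is_argmin
    (fun x => taylor p f x y + N / (p%:R * s) * enorm (x - y) ^+ p) (G y).

Definition tensor_update_operator (p : nat) (s M : R) f
    (G : 'rV[R]_n -> 'rV[R]_n) :=
  exists2 N : R, 0 < N & tensor_update p s N f G /\
    forall y, M * s `^ (p.-1%:R^-1)
                * enorm (grad f (G y)) `^ (p%:R / p.-1%:R)
              <= dot (grad f (G y)) (y - G y).

End Euclidean.

Section HyperbolicSine.
Variable R : realType.

(* S solves S' = (1 + S^p)^(1/p), S(0) = 0 on [0, +oo[: the increments h are
   restricted to 0 <= t + h, so the derivative is two-sided for t > 0 and
   one-sided at t = 0.  Values of S at negative reals are irrelevant. *)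
Definition is_sinhp (p : nat) (S : R -> R) :=
  S 0 = 0 /\
  forall t, 0 <= t ->
    h^-1 * (S (t + h) - S t) @[h --> within [set h | 0 <= t + h] 0^']
      --> (1 + S t ^+ p) `^ (p%:R^-1).

Definition sinhc (S : R -> R) (x : R) : R := if x == 0 then 1 else S x / x.

End HyperbolicSine.

(* Main.v *)
Require Import Defs.
From mathcomp Require Import all_boot all_order all_algebra.
From mathcomp Require Import all_classical all_reals all_analysis.
From mathcomp Require Import ring lra.
Set Implicit Arguments.
Unset Strict Implicit.
Unset Printing Implicit Defensive.
Import Order.TTheory GRing.Theory Num.Theory.
Import numFieldNormedType.Exports.
Local Open Scope classical_set_scope.
Local Open Scope ring_scope.

(** The decrease of the energy is the mirror-descent estimate combined with the
descent property of the tensor step.  Write a = A_{k+1} - A_k, A' = A_{k+1},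
B = 1 + mu A_k, so that 1 + mu A' = B + mu a, and g = grad f (x_{k+1}).

- [mirror_step]: the optimality condition of z_{k+1}, paired with the three-point
  identity for Bregman divergences, bounds
  (B + mu a) D_h(x*, z_{k+1}) + B D_h(z_{k+1}, z_k) by B D_h(x*, z_k) plus
  mu a D_h(x*, x_{k+1}) and the linear term a <g, x* - z_{k+1}>.
- Uniform convexity of f between x* and x_{k+1} (weight a) and convexity between
  x_k and x_{k+1} (weight A_k) turn the function values into linear terms and
  absorb mu a D_h(x*, x_{k+1}).  Since A' y_k = A_k x_k + a z_k,
  all linear terms collapse to a <g, z_k - z_{k+1}> - A' <g, y_k - x_{k+1}>.
- With d = |z_{k+1} - z_k|, the first of these is at most a |g| d, the subtracted
  one at least A' M s^(1/(p-1)) |g|^(p/(p-1)) by the defining property of the tensor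
  operator, and B D_h(z_{k+1}, z_k) >= (B/p) d^p.  Hence the energy does not
  increase as soon as
    a |g| d <= (B/p) d^p + A' M s^(1/(p-1)) |g|^(p/(p-1)).
  This is Young's inequality with exponents p and p/(p-1), and the growth
  condition on A is exactly what makes its constants match ([tensor_gain]).

The explicit formula for A_k enters only through 0 <= A_k <= A_{k+1}.  This holds
because t sinhc_p(c t) is sinh_p(c t) / c when c > 0 and t when c = 0, and sinh_p
has a nonnegative derivative on the half-line ([sinhp_nondecreasing],
[mul_sinhc_nondecreasing]). *)

(** * Euclidean geometry and first-order optimality *)

Section Euclidean.
Context {R : realType} {n : nat}.
Implicit Types (u v w x z : 'rV[R]_n) (g h : 'rV[R]_n -> R).

Lemma dotC u v : dot u v = dot v u.
Proof. by apply: eq_bigr => i _; rewrite mulrC. Qed.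

Lemma dotDr u v w : dot u (v + w) = dot u v + dot u w.
Proof. by rewrite /dot -big_split; apply: eq_bigr => i _; rewrite mxE mulrDr. Qed.

Lemma dotZr (c : R) u v : dot u (c *: v) = c * dot u v.
Proof. by rewrite /dot mulr_sumr; apply: eq_bigr => i _; rewrite mxE mulrCA. Qed.

Lemma dotNr u v : dot u (- v) = - dot u v.
Proof. by rewrite -scaleN1r dotZr mulN1r. Qed.

Lemma dotBr u v w : dot u (v - w) = dot u v - dot u w.
Proof. by rewrite dotDr dotNr. Qed.

Lemma dotZl (c : R) u v : dot (c *: u) v = c * dot u v.
Proof. by rewrite !(dotC _ v) dotZr. Qed.

Lemma dotBl u v w : dot (u - v) w = dot u w - dot v w.
Proof. by rewrite !(dotC _ w) dotBr. Qed.

Lemma dot_ge0 u : 0 <= dot u u.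
Proof. by apply: sumr_ge0 => i _; rewrite -expr2 sqr_ge0. Qed.

Lemma enorm_ge0 u : 0 <= enorm u.
Proof. exact: sqrtr_ge0. Qed.

Lemma sqr_enorm u : enorm u ^+ 2 = dot u u.
Proof. by rewrite sqr_sqrtr ?dot_ge0. Qed.

Lemma enorm_eq0 u : enorm u = 0 -> u = 0.
Proof.
move=> u0; have /eqP : dot u u = 0 by rewrite -sqr_enorm u0 expr0n.
rewrite psumr_eq0 => [/allP u_eq0|i _]; last by rewrite -expr2 sqr_ge0.
apply/rowP => i; rewrite mxE.
by have := u_eq0 i (mem_index_enum _); rewrite mulf_eq0 orbb => /eqP.
Qed.

Lemma enormN u : enorm (- u) = enorm u.
Proof. by rewrite /enorm dotNr dotC dotNr opprK. Qed.

(** Cauchy-Schwarz, from the nonnegativity of the square of |v| u - |u| v. *)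
Lemma dot_le_enorm u v : dot u v <= enorm u * enorm v.
Proof.
have [u0|u0] := eqVneq (enorm u) 0.
  by rewrite u0 mul0r (enorm_eq0 u0) /dot big1// => i _; rewrite mxE mul0r.
have [v0|v0] := eqVneq (enorm v) 0.
  by rewrite v0 mulr0 (enorm_eq0 v0) /dot big1// => i _; rewrite mxE mulr0.
have := dot_ge0 (enorm v *: u - enorm u *: v).
rewrite !(dotBl, dotBr, dotZl, dotZr) -!sqr_enorm (dotC v u).
set a := enorm u; set b := enorm v.
have ab : 0 < a * b by rewrite mulr_gt0// lt_def ?u0 ?v0 enorm_ge0.
move=> ?; rewrite -(ler_pM2l ab); lra.
Qed.

(** The gradient is defined by partial derivatives; differentiability is what
makes it represent the derivative in every direction. *)
Lemma derive_grad g x v : differentiable g x -> 'D_v g x = dot (grad g x) v.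
Proof.
move=> dg; rewrite deriveE// {1}(row_sum_delta v) linear_sum.
by apply: eq_bigr => i _; rewrite linearZ/= -deriveE// mxE mulrC.
Qed.

(** The difference quotients of the objective along v from the minimizer are
nonnegative for positive increments, and the stated quantity is their limit. *)
Lemma argmin_first_order (c : R) u h x : differentiable h x ->
  is_argmin (fun w => c * h w + dot u w) x ->
  forall v, 0 <= c * dot (grad h x) v + dot u v.
Proof.
move=> dh xmin v.
have hcvg : e^-1 *: (h (e *: v + x) - h x) @[e --> 0^'+] --> 'D_v h x.
  by apply: cvg_dnbhs_at_right; exact: (diff_derivable (v := v) dh).
rewrite -derive_grad//.
apply: (@cvgr_to_ge _ 0^'+ _ _ (fun e => c * (e^-1 *: (h (e *: v + x) - h x))
  + dot u v)).
  by apply: cvgD; [apply: cvgM; [exact: cvg_cst|]|exact: cvg_cst].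
near=> e; have e0 : 0 < e by near: e; exact: nbhs_right_gt.
have := xmin (e *: v + x); rewrite -subr_ge0 dotDr dotZr.
set q := (X in 0 <= X) => q0.
have -> : c * (e^-1 *: (h (e *: v + x) - h x)) + dot u v = e^-1 * q.
  by rewrite /q /GRing.scale/=; field; exact: lt0r_neq0.
by rewrite mulr_ge0// invr_ge0 ltW.
Unshelve. all: by end_near. Qed.

(** Up to an additive constant the minimized function is c h(w) + <u, w>.  Its
first-order condition at z', in the direction w - z' and multiplied by B, is the
claimed inequality once the gradient terms are regrouped into Bregman
divergences (three-point identity). *)
Lemma mirror_step (a B mu : R) h (g x z z' : 'rV[R]_n) : 0 < B ->
  (forall w, differentiable h w) ->
  is_argmin (fun w => a / B * (dot g w + mu * bregman h w x) + bregman h w z) z' ->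
  forall w, (B + mu * a) * bregman h w z' + B * bregman h z' z
              + mu * a * bregman h z' x
            <= B * bregman h w z + mu * a * bregman h w x + a * dot g (w - z').
Proof.
move=> B0 dh zmin w.
pose c := a / B * mu + 1.
pose u := (a / B) *: (g - mu *: grad h x) - grad h z.
have umin : is_argmin (fun w => c * h w + dot u w) z'.
  move=> w'; have := zmin w'.
  by rewrite /bregman /c /u !(dotBl, dotZl, dotBr); lra.
have := argmin_first_order (dh z') umin (w - z').
move=> /(mulr_ge0 (ltW B0)) Bfirst; rewrite -subr_ge0.
apply: le_trans Bfirst _; rewrite le_eqVlt; apply/orP; left; apply/eqP.
by rewrite /bregman /c /u !(dotBl, dotZl, dotBr); field; rewrite lt0r_neq0.
Qed.

End Euclidean.

(** * Young's inequality and the tensor step *)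

(** Young's inequality with exponents m+1 and (m+1)/m, written with natural
powers only: the difference of the two sides for m+1 is x times the difference
for m plus (m+1) y^m (x - y)^2. *)
Lemma young_natpow {R : realDomainType} (m : nat) (x y : R) : 0 <= x -> 0 <= y ->
  m.+1%:R * (x * y ^+ m) <= x ^+ m.+1 + m%:R * y ^+ m.+1.
Proof.
move=> x0 y0; elim: m => [|m IH]; first by rewrite !expr1 mul0r addr0 !mul1r mulr1.
rewrite -subr_ge0.
have -> : x ^+ m.+2 + m.+1%:R * y ^+ m.+2 - m.+2%:R * (x * y ^+ m.+1)
  = x * (x ^+ m.+1 + m%:R * y ^+ m.+1 - m.+1%:R * (x * y ^+ m))
    + m.+1%:R * (y ^+ m * (x - y) ^+ 2).
  rewrite !exprS -!natr1; ring.
apply: addr_ge0; first by rewrite mulr_ge0 ?subr_ge0.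
by apply: mulr_ge0 => //; rewrite mulr_ge0 ?sqr_ge0 ?exprn_ge0.
Qed.

(** Young's inequality scaled so as to be applied to x = B^(1/p) d and
y = (lam |g|^(p/(p-1)))^(1/p), with lam chosen so that the second term on the
right is ((p-1)/p) lam |g|^(p/(p-1)).  The left factor a is then at most
(B lam^(p-1))^(1/p), whose p-th power is the bound assumed on a^p.  Here e stands
for |g|. *)
Lemma tensor_gain {R : realType} (p : nat) (a B A s M d e : R) :
  (2 <= p)%N -> 0 <= a -> 0 < B -> 0 <= A -> 0 < s -> 0 < M -> 0 <= d -> 0 <= e ->
  a ^+ p <= p%:R^-1 * (M / p.-1%:R) ^+ p.-1 * p%:R ^+ p * s * A ^+ p.-1 * B ->
  a * (e * d) <= B * (p%:R^-1 * d ^+ p)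
    + A * (M * s `^ (p.-1%:R^-1) * e `^ (p%:R / p.-1%:R)).
Proof.
case: p => [|[|m]]// _ a0 B0 A0 s0 M0 d0 e0; rewrite [_.-1]/=.
set k := m.+1; set p := k.+1.
have k0 : 0 < k%:R :> R by rewrite ltr0n.
have p0 : 0 < p%:R :> R by rewrite ltr0n.
have rootK (n : nat) (r : R) : (0 < n)%N -> 0 <= r -> (r `^ (n%:R^-1)) ^+ n = r.
  move=> n0 r0; rewrite -powR_mulrn ?powR_ge0// -powRrM mulVf ?powRr1//.
  by rewrite pnatr_eq0 -lt0n.
set sg := s `^ _; have sgE : sg ^+ k = s by rewrite rootK// ltW.
have sg0 : 0 <= sg by exact: powR_ge0.
pose r := e `^ (k%:R^-1); have r0 : 0 <= r by exact: powR_ge0.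
have erk : e = r ^+ k by rewrite rootK.
have -> : e `^ (p%:R / k%:R) = r ^+ p.
  by rewrite mulrC powRrM powR_mulrn// powR_ge0.
pose lam := A * M * sg * p%:R / k%:R.
have lam0 : 0 <= lam by rewrite !mulr_ge0 ?invr_ge0 ?(ltW k0) ?(ltW M0) ?(ltW p0).
pose b := B `^ (p%:R^-1); have b0 : 0 <= b by exact: powR_ge0.
have bE : b ^+ p = B by rewrite rootK// ltW.
pose l := lam `^ (p%:R^-1); have l0 : 0 <= l by exact: powR_ge0.
have lE : l ^+ p = lam by rewrite rootK.
move=> ap.
have abl : a <= b * l ^+ k.
  rewrite -(@ler_pXn2r _ p) ?nnegrE ?mulr_ge0 ?exprn_ge0//.
  rewrite exprMn bE -exprM mulnC exprM lE (le_trans ap)//.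
  (* The two sides agree: this is how the growth condition fixes lam. *)
  rewrite le_eqVlt; apply/orP; left; apply/eqP.
  rewrite /lam -sgE !exprMn [p%:R ^+ p]exprS; field.
  by rewrite !gt_eqF.
have := young_natpow k (mulr_ge0 b0 d0) (mulr_ge0 l0 r0).
rewrite -/p !exprMn bE lE -(ler_pM2l (_ : 0 < p%:R^-1)) ?invr_gt0// => young.
apply: (@le_trans _ _ (b * d * (l ^+ k * r ^+ k))).
  have -> : b * d * (l ^+ k * r ^+ k) = b * l ^+ k * (e * d) by rewrite erk; ring.
  by rewrite ler_wpM2r// mulr_ge0.
move: young; rewrite mulKf ?gt_eqF// => /le_trans; apply.
rewrite le_eqVlt; apply/orP; left; apply/eqP.
by rewrite /lam; field; rewrite !gt_eqF.
Qed.

(** * Monotonicity of the hyperbolic sine *)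

(** The right-hand side of the differential equation is a real power, hence
nonnegative, so the mean value theorem applies on the half-line. *)
Lemma sinhp_nondecreasing {R : realType} (p : nat) (S : R -> R) : is_sinhp p S ->
  forall a b, 0 <= a -> a <= b -> S a <= S b.
Proof.
move=> [S0 dS].
have dS_pos (t : R) : 0 < t ->
    h^-1 *: (S (h *: 1 + t) - S t) @[h --> 0^'] --> (1 + S t ^+ p) `^ (p%:R^-1).
  move=> t0; have -> : (fun h => h^-1 *: (S (h *: 1 + t) - S t))
          = (fun h => h^-1 * (S (t + h) - S t)).
    by apply/funext => h; rewrite [_ *: 1]mulr1 (addrC h).
  apply: cvg_trans (dS t (ltW t0)); apply: cvg_app => P nP.
  have nt : \forall h \near 0^', - t < h.
    by apply: cvg_within; apply: lt_nbhsr; rewrite oppr_lt0.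
  have nP' : \forall h \near 0^', 0 <= t + h -> P h := nP.
  apply: filterS (filterI nP' nt) => h [Ph th]; apply: Ph.
  by rewrite /= addrC -lerBlDr sub0r ltW.
have derS (t : R) : 0 < t -> derivable S t 1 by move=> /dS_pos/cvgP.
apply: ger0_derive1_ndecry => [t|t|].
- by rewrite in_itv/= andbT => /derS.
- rewrite in_itv/= andbT => t0.
  have -> : (S^`())%classic t = (1 + S t ^+ p) `^ (p%:R^-1).
    by rewrite derive1E; apply: cvg_lim => //; exact: dS_pos.
  exact: powR_ge0.
- apply/continuous_within_itvcyP; split=> [t|].
    rewrite in_itv/= andbT => t0.
    exact/differentiable_continuous/derivable1_diffP/derS.
  (* Right-continuity at 0: S h is h times a convergent quotient, plus S 0. *)
  have quotient : h^-1 * (S h - S 0) @[h --> 0^'+] --> (1 + S 0 ^+ p) `^ (p%:R^-1).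
    have -> : (fun h => h^-1 * (S h - S 0)) = (fun h => h^-1 * (S (0 + h) - S 0)).
      by apply/funext => h; rewrite add0r.
    apply: cvg_trans (dS 0 (lexx 0)); apply: cvg_app => P nP.
    have nP' : \forall h \near 0, h != 0 -> 0 <= 0 + h -> P h := nP.
    apply: filterS nP' => h Ph h0; apply: Ph; first exact: lt0r_neq0.
    by rewrite /= add0r ltW.
  have lim0 : h * (h^-1 * (S h - S 0)) + S 0 @[h --> 0^'+] --> S 0.
    rewrite -[X in _ --> X]add0r.
    rewrite -[X in _ --> X + _](mul0r ((1 + S 0 ^+ p) `^ (p%:R^-1))).
    apply: cvgD; last exact: cvg_cst.
    by apply: cvgM => //; apply: cvg_at_right_filter; exact: cvg_id.
  apply: cvg_trans lim0; apply: near_eq_cvg; near=> h.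
  have h0 : 0 < h by near: h; exact: nbhs_right_gt.
  by rewrite mulVKf ?gt_eqF// subrK.
Unshelve. all: by end_near. Qed.

(** For c > 0 the expression equals S(c a) / c; for c = 0, which corresponds to
mu = 0, it is a. *)
Lemma mul_sinhc_nondecreasing {R : realType} (p : nat) (S : R -> R) (c : R) :
  is_sinhp p S -> 0 <= c -> forall a b, 0 <= a -> a <= b ->
  0 <= a * sinhc S (c * a) <= b * sinhc S (c * b).
Proof.
move=> hS; have [S0 _] := hS.
rewrite le_eqVlt => /predU1P[<- a b a0 ab|c0].
  by rewrite !mul0r /sinhc eqxx !mulr1 a0.
have sE a : a * sinhc S (c * a) = S (c * a) / c.
  rewrite /sinhc mulf_eq0 gt_eqF//=; have [->|a0] := eqVneq a 0.
    by rewrite mulr0 S0 !mul0r.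
  by field; rewrite a0 gt_eqF.
move=> a b a0 ab; rewrite !sE divr_ge0 ?(ltW c0)//= ?ler_pM2r ?invr_gt0//.
  apply: (sinhp_nondecreasing hS); first by rewrite mulr_ge0// ltW.
  by rewrite ler_pM2l.
by rewrite -S0; apply: (sinhp_nondecreasing hS); rewrite // mulr_ge0// ltW.
Qed.

(** * Decrease of the energy *)

Theorem theorem17 (R : realType) (n p : nat) (mu s M : R)
    (h f : 'rV[R]_n -> R) (xstar : 'rV[R]_n)
    (G : 'rV[R]_n -> 'rV[R]_n) (sinhp : R -> R) (C : R)
    (t A : nat -> R) (x y z : nat -> 'rV[R]_n)
    (hp : (2 <= p)%N) (hmu : 0 <= mu) (hs : 0 < s) (hM : 0 < M)
    (h_C1 : continuously_differentiable h)
    (h_uc : uniformly_convex_order p h)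
    (f_C1 : continuously_differentiable f)
    (f_diff : times_differentiable p.-1 f)
    (f_uc : uniformly_convex_wrt mu h f)
    (f_smooth : smooth_of_order p.-1 ((p.-1)`!%:R / s) f)
    (xstar_min : is_argmin f xstar)
    (hG : tensor_update_operator p s M f G)
    (hsinhp : is_sinhp p sinhp)
    (hC : C = p%:R^-1 * (M / p.-1%:R) ^+ p.-1)
    (t_ge0 : forall k, 0 <= t k)
    (t_incr : forall k, t k < t k.+1)
    (hA : forall k, A k = C * t k ^+ p *
       sinhc sinhp (C `^ (p%:R^-1) * mu `^ (p%:R^-1) * t k) ^+ p)
    (A_cond : forall k,
       (A k.+1 - A k) ^+ p
         - C * p%:R ^+ p * s * A k.+1 ^+ p.-1 * (1 + mu * A k) <= 0)
    (xz0 : x 0%N = z 0%N)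
    (hy : forall k, y k = x k + ((A k.+1 - A k) / A k.+1) *: (z k - x k))
    (hx : forall k, x k.+1 = G (y k))
    (hz : forall k, is_argmin
       (fun w => (A k.+1 - A k) / (1 + mu * A k)
                   * (dot (grad f (x k.+1)) w + mu * bregman h w (x k.+1))
                 + bregman h w (z k)) (z k.+1)) :
  nonincreasing_seq (fun k =>
    (1 + mu * A k) * bregman h xstar (z k) + A k * (f (x k) - f xstar)).
Proof.
have hD u v : 0 <= bregman h u v.
  by apply: le_trans (h_uc v u); rewrite mulr_ge0 ?invr_ge0 ?exprn_ge0 ?enorm_ge0.
have C0 : 0 <= C.
  by rewrite hC mulr_ge0 ?invr_ge0 ?ler0n ?exprn_ge0 ?divr_ge0 ?ler0n ?(ltW hM).
pose c := C `^ (p%:R^-1) * mu `^ (p%:R^-1).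
have c0 : 0 <= c by rewrite mulr_ge0 ?powR_ge0.
have AE k : A k = C * (t k * sinhc sinhp (c * t k)) ^+ p.
  by rewrite hA exprMn mulrA.
have tk k := mul_sinhc_nondecreasing hsinhp c0 (t_ge0 k) (ltW (t_incr k)).
have A0 k : 0 <= A k.
  by rewrite AE mulr_ge0// exprn_ge0//; case/andP: (tk k).
have Ainc k : A k <= A k.+1.
  rewrite !AE ler_wpM2l// lerXn2r ?nnegrE//; first by case/andP: (tk k).
    by case/andP: (tk k.+1).
  by case/andP: (tk k).
case: hG => N N0 [_ hGM].
apply/nonincreasing_seqP => k.
have zk_min := hz k; set a := A k.+1 - A k in zk_min.
set B := 1 + mu * A k in zk_min *; set g := grad f (x k.+1) in zk_min.
have a0 : 0 <= a by rewrite subr_ge0.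
have B0 : 0 < B by rewrite ltr_pwDl// mulr_ge0.
have mirror := mirror_step B0 h_C1.1 zk_min xstar.
have cvx_star : a * (mu * bregman h xstar (x k.+1)) <= a * bregman f xstar (x k.+1).
  by rewrite ler_wpM2l// f_uc.2.
have cvx_x : 0 <= A k * bregman f (x k) (x k.+1).
  by rewrite mulr_ge0//; apply: le_trans (f_uc.2 _ _); rewrite mulr_ge0.
have Ay : A k.+1 * dot g (y k) = A k * dot g (x k) + a * dot g (z k).
  rewrite hy !(dotBr, dotDr, dotZr) -/a.
  (* If A k.+1 = 0 then A k = 0 and a = 0, and the identity is trivial. *)
  have [A1|A1] := eqVneq (A k.+1) 0; last by rewrite /a; field.
  have A00 : A k = 0 by apply/eqP; rewrite eq_le A0 -A1 Ainc.
  by rewrite /a A1 A00; ring.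
have ineqA : a ^+ p <= p%:R^-1 * (M / p.-1%:R) ^+ p.-1 * p%:R ^+ p * s
                * A k.+1 ^+ p.-1 * B.
  by rewrite -hC -subr_le0 A_cond.
have gain := tensor_gain hp a0 B0 (A0 k.+1) hs hM (enorm_ge0 (z k.+1 - z k))
  (enorm_ge0 g) ineqA.
have cs : a * dot g (z k - z k.+1) <= a * (enorm g * enorm (z k.+1 - z k)).
  by rewrite -(enormN (z k.+1 - z k)) opprB ler_wpM2l// dot_le_enorm.
have uc : B * (p%:R^-1 * enorm (z k.+1 - z k) ^+ p) <= B * bregman h (z k.+1) (z k).
  by rewrite ler_wpM2l// ltW.
have descent : A k.+1 * (M * s `^ (p.-1%:R^-1) * enorm g `^ (p%:R / p.-1%:R))
    <= A k.+1 * dot g (y k - x k.+1).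
  by rewrite ler_wpM2l// /g hx hGM.
have nonneg : 0 <= mu * a * bregman h (z k.+1) (x k.+1) by rewrite !mulr_ge0.
have -> : 1 + mu * A k.+1 = B + mu * a by rewrite /B /a; ring.
have total := le_trans cs (le_trans gain (lerD uc descent)).
have bregman_fE u : bregman f u (x k.+1) = f u - f (x k.+1) - dot g (u - x k.+1).
  by [].
move: mirror cvx_star cvx_x total.
rewrite !bregman_fE !dotBr (mulrBr (A k.+1)) Ay.
have -> : A k.+1 = A k + a by rewrite /a; ring.
clearbody a B; lra.
Qed.
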